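(* Let $S$ be a finite semilattice. Then the set $I(S)$ of irreducible elements of $S$ is the unique minimal generating set of $S$.
   Context: A semilattice is a non-empty commutative semigroup all of whose elements are idempotent. An element $s$ of a semilattice $S$ is irreducible if $s=ab$ with $a,b\in S$ implies $a=s$ or $b=s$; $I(S)$ is the set of all irreducible elements of $S$. A generating set of $S$ is a non-empty subset $A\subseteq S$ such that every element of $S$ is a product of one or more elements of $A$; it is minimal if no proper subset of $A$ is a generating set of $S$. *)

(* Defs.v *)
From HB Require Import structures.
From mathcomp Require Import all_boot.

Set Implicit Arguments.
Unset Strict Implicit.
Unset Printing Implicit Defensive.

Local Open Scope group_scope.

HB.mixin Record Semigroup_isSemilattice S of Semigroup S := {
  slmulC : commutative (@mul S);
  slmulxx : forall x : S, x * x = x;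
  sl_inhabited : inhabited S
}.

#[short(type="semilatticeType")]
HB.structure Definition Semilattice :=
  { S of Semigroup_isSemilattice S & Semigroup S }.

#[short(type="finSemilatticeType")]
HB.structure Definition FinSemilattice := { S of Semilattice S & Finite S }.

Section Irreducible.

Variable S : finSemilatticeType.
Implicit Types (s x : S) (l : seq S) (A : {set S}).

Definition irreducible s : bool :=
  [forall a, forall b, (s == a * b) ==> (a == s) || (b == s)].

Definition irreducibles : {set S} := [set s | irreducible s].

(* [foldl *%g x l] is the product of the non-empty word [x :: l]; a semilattice
   need not have an identity, so there is no empty product. *)
Definition is_product_of A s : Prop :=
  exists x l, [/\ x \in A, {subset l <= A} & s = foldl *%g x l].

Definition generating A : Prop :=
  A != set0 /\ forall s, is_product_of A s.

Definition minimal_generating A : Prop :=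
  generating A /\ forall B : {set S}, B \proper A -> ~ generating B.

End Irreducible.

Arguments irreducibles S : clear implicits.

(* Main.v *)
Require Import Defs.
From mathcomp Require Import all_boot.

(** Order [S] by [s <= y] iff [s * y = s], so that products are meets.  Two
    facts give the theorem.

    An irreducible element that is written as a product of elements of [A] is
    one of the factors: peel the factors off one at a time.  Hence every
    generating set contains all the irreducibles
    ([irreducibles_sub_generating]).

    Conversely a reducible [s] is [a * b] with [a] and [b] strictly above [s].
    As [S] is finite this splitting process stops, and it can only stop at
    irreducibles; so the irreducibles generate ([generating_irreducibles]).

    The irreducibles are therefore the least generating set for inclusion, and
    a least element is the unique minimal one. *)

Set Implicit Arguments.
Unset Strict Implicit.
Unset Printing Implicit Defensive.

Local Open Scope group_scope.

Lemma mul_foldl (G : semigroupType) (a y : G) (l : seq G) :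
  a * foldl *%g y l = foldl *%g (a * y) l.
Proof. by elim: l y => //= z l IHl y; rewrite IHl mulgA. Qed.

Section FiniteSemilattice.

Variable S : finSemilatticeType.
Implicit Types (a b s x y : S) (l : seq S) (A : {set S}).

Lemma irreducibleP s :
  reflect (forall a b, s = a * b -> a = s \/ b = s) (irreducible s).
Proof.
apply: (iffP forallP) => [irr a b sE | irr a].
  have /forallP/(_ b)/implyP := irr a.
  by rewrite -sE eqxx => /(_ isT)/orP[] /eqP; [left | right].
apply/forallP => b; apply/implyP => /eqP sE.
by case: (irr a b sE) => ->; rewrite eqxx ?orbT.
Qed.

Lemma irreducible_mem_factors x l :
  irreducible (foldl *%g x l) -> foldl *%g x l \in x :: l.
Proof.
elim/last_ind: l => [|l y IHl]; first by rewrite mem_head.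
rewrite foldl_rcons => irr.
have [prefE | <-] := irreducibleP _ irr _ _ erefl; last first.
  by rewrite inE mem_rcons mem_head orbT.
rewrite -prefE in irr *; have := IHl irr.
by rewrite !inE mem_rcons inE => /orP[-> // | ->]; rewrite !orbT.
Qed.

Lemma irreducibles_sub_generating A : generating A -> irreducibles S \subset A.
Proof.
case=> _ genA; apply/subsetP => s; rewrite inE => irr.
have [x [l [Ax lA sE]]] := genA s.
rewrite sE in irr *.
by have := irreducible_mem_factors irr; rewrite inE => /predU1P[-> | /lA].
Qed.

Lemma is_product_of_mul A a b :
  is_product_of A a -> is_product_of A b -> is_product_of A (a * b).
Proof.
move=> [x [l [Ax lA ->]]] [y [m [Ay mA ->]]].
exists x, (l ++ y :: m); split=> //; last by rewrite foldl_cat /= mul_foldl.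
by move=> z; rewrite mem_cat inE => /or3P[/lA | /eqP-> | /mA].
Qed.

Definition upset s : {set S} := [set y | s * y == s].

(** The size of the upset is thus a termination measure for splitting reducible
    elements. *)
Lemma upset_factor_proper a b : a != a * b -> upset a \proper upset (a * b).
Proof.
move=> neq; apply/properP; split.
  apply/subsetP => y; rewrite !inE => /eqP ay.
  by rewrite -mulgA (slmulC b) mulgA ay.
(* [a * b] separates the two upsets: it lies above itself, but not above [a]. *)
exists (a * b); first by rewrite inE slmulxx.
by rewrite inE mulgA slmulxx eq_sym.
Qed.

Lemma is_product_of_irreducibles s : is_product_of (irreducibles S) s.
Proof.
have [n] := ubnP #|upset s|; elim: n s => // n IHn s /ltnSE le_s_n.
have [irr | /forallPn[a /forallPn[b]]] := boolP (irreducible s).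
  by exists s, [::]; rewrite inE irr.
rewrite negb_imply negb_or => /and3P[/eqP sE a_s b_s]; rewrite sE in a_s b_s le_s_n *.
apply: is_product_of_mul; apply: IHn; apply: leq_trans le_s_n; apply: proper_card.
  exact: upset_factor_proper.
by rewrite slmulC upset_factor_proper // slmulC.
Qed.

Lemma generating_irreducibles : generating (irreducibles S).
Proof.
split; last exact: is_product_of_irreducibles.
have [s] := @sl_inhabited S; apply/set0Pn.
by have [x [l [Ix _ _]]] := is_product_of_irreducibles s; exists x.
Qed.

End FiniteSemilattice.

Theorem lemma3p3 (S : finSemilatticeType) :
  minimal_generating (irreducibles S) /\
  (forall A : {set S}, minimal_generating A -> A = irreducibles S).
Proof.
split=> [|A [genA minA]].
  split=> [|B /andP[_ notIB] genB]; first exact: generating_irreducibles.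
  by rewrite irreducibles_sub_generating in notIB.
have := irreducibles_sub_generating genA; rewrite subEproper.
by case/predU1P => [-> // | /minA[]]; apply: generating_irreducibles.
Qed.
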